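(* Let $R$ be an associative ring with unity $1$, and let $a,b\in R$ be Drazin invertible elements. If $a^2b=aba$, $b^2a=bab$ and $\mathrm{ind}(a)=s$, then $a+b$ is Drazin invertible if and only if $1+a^Db$ is Drazin invertible. Moreover, in this case, $$(a+b)^D = a^D(1+a^Db)^D+a^\pi b\,[a^D(1+a^Db)^D]^2+\sum_{i=0}^{s-1}(b^D)^{i+1}(-a)^ia^\pi + b^\pi a \sum_{i=0}^{s-2}(i+1)(b^D)^{i+2}(-a)^ia^\pi,$$ and $$(1+a^Db)^D=a^\pi +a^2a^D(a+b)^D.$$
   Context: An element $a\in R$ is Drazin invertible if there exists $x\in R$ such that $ax=xa$, $xax=x$ and $a^k=a^{k+1}x$ for some positive integer $k$; such an $x$ is unique and is denoted $a^D$ (the Drazin inverse of $a$). The least such positive integer $k$ is the Drazin index of $a$, denoted $\mathrm{ind}(a)$ (so $\mathrm{ind}(a)\ge 1$). For Drazin invertible $a$, $a^\pi=1-aa^D$ is the spectral idempotent of $a$. Zeroth powers are $1$, and the empty sum (the last sum when $s=1$) is $0$. *)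

(* Defs.v *)
From mathcomp Require Import all_boot all_order all_algebra.

Set Implicit Arguments.
Unset Strict Implicit.
Unset Printing Implicit Defensive.

Import GRing.Theory.
Local Open Scope ring_scope.

(* [is_drazin_inverse a x] is the relation x = a^D; it determines x uniquely
   (see [is_drazin_inverse_unique]), so a^D is represented by any x satisfying
   it.  Rings are [pzRingType]: unital, associative, the zero ring allowed. *)
Definition is_drazin_inverse (R : pzRingType) (a x : R) : Prop :=
  [/\ a * x = x * a,
      x * a * x = x
    & exists2 k : nat, (0 < k)%N & a ^+ k = a ^+ k.+1 * x].

Definition drazin_invertible (R : pzRingType) (a : R) : Prop :=
  exists x : R, is_drazin_inverse a x.

(* The relation ind(a) = s. *)
Definition is_drazin_index (R : pzRingType) (a : R) (s : nat) : Prop :=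
  exists2 x : R, is_drazin_inverse a x &
    [/\ (0 < s)%N,
        a ^+ s = a ^+ s.+1 * x
      & forall k : nat, (0 < k)%N -> a ^+ k = a ^+ k.+1 * x -> (s <= k)%N].

(* a^pi, where ad is the Drazin inverse of a. *)
Definition spectral_idempotent (R : pzRingType) (a ad : R) : R := 1 - a * ad.

Lemma drazin_power_eq (R : pzRingType) (a x : R) (k n : nat) :
  (k <= n)%N -> a ^+ k = a ^+ k.+1 * x -> a ^+ n = a ^+ n.+1 * x.
Proof.
move=> le_kn eq_k; rewrite -(subnK le_kn) -addnS !exprD.
by rewrite [in LHS]eq_k mulrA.
Qed.

Lemma is_drazin_inverse_unique (R : pzRingType) (a x y : R) :
  is_drazin_inverse a x -> is_drazin_inverse a y -> x = y.
Proof.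
move=> [cx xax [k _ ek]] [cy yay [l _ el]].
have ex := drazin_power_eq (leq_maxl k l) ek.
have ey := drazin_power_eq (leq_maxr k l) el.
move: (maxn k l) ex ey => n ex ey {k l ek el}.
have xE m : x = x ^+ m.+1 * a ^+ m.
  elim: m => [|m IHm]; first by rewrite expr1 mulr1.
  have -> : x ^+ m.+2 * a ^+ m.+1 = x * (x ^+ m.+1 * a ^+ m) * a.
    by rewrite (exprS x m.+1) (exprSr a m) !mulrA.
  by rewrite -IHm -mulrA -cx mulrA xax.
have yE m : y = a ^+ m * y ^+ m.+1.
  elim: m => [|m IHm]; first by rewrite expr1 mul1r.
  have -> : a ^+ m.+1 * y ^+ m.+2 = a * (a ^+ m * y ^+ m.+1) * y.
    by rewrite (exprS a m) (exprSr y m.+1) !mulrA.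
  by rewrite -IHm cy yay.
have xay : x = x * a * y.
  rewrite {1}(xE n) ey (exprSr a n).
  by rewrite -(mulrA _ a y) mulrA -xE mulrA.
have yxa : y = x * a * y.
  have cxn : a ^+ n.+1 * x = x * a ^+ n.+1 by apply/esym/commrX/esym.
  rewrite {1}(yE n) ex cxn (exprS a n).
  by rewrite (mulrA x) -mulrA -yE.
by rewrite xay -yxa.
Qed.

Lemma drazin_index_exists (R : pzRingType) (a : R) :
  drazin_invertible a -> exists s : nat, is_drazin_index a s.
Proof.
case=> x ax; have [_ _ [k k_gt0 ek]] := ax.
have exP : exists n : nat, (0 < n)%N && (a ^+ n == a ^+ n.+1 * x).
  by exists k; rewrite k_gt0 -ek eqxx.
exists (ex_minn exP); exists x => //.
case: ex_minnP => n /andP[n_gt0 /eqP en] min_n; split=> // m m_gt0 em.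
by apply: min_n; rewrite m_gt0 -em eqxx.
Qed.

(* Main.v *)
Require Import Defs.
From mathcomp Require Import all_boot all_order all_algebra.

Import GRing.Theory.
Local Open Scope ring_scope.

(** With [c = ab - ba], the hypotheses say [a c = b c = 0].  Hence after any
    left factor annihilating [c], such as [a], [b] and their Drazin inverses,
    all elements generated by [a], [b] and Drazin inverses commute.
    Consequently, if [w = a + b] and [z] is a Drazin inverse of [w] up to left
    multiplication by [w], then [w z^2] is the Drazin inverse of [w].  Such a
    [z] is obtained by splitting along [e = a a^D]: on the range of [e],
    [e w = a (1 + a^D b) e] has Drazin inverse [a^D (1 + a^D b)^D]; on the range
    of [a^pi], [a] is nilpotent and the geometric series
    [sum_i (b^D)^(i+1) (-a)^i a^pi] does the job. *)

(** * Powers and commutants of Drazin inverses *)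

Lemma drazin_powE (R : pzRingType) (q d : R) (n : nat) :
  is_drazin_inverse q d -> d = d ^+ n.+1 * q ^+ n.
Proof.
case=> cqd dqd _; elim: n => [|n IHn]; first by rewrite expr1 mulr1.
by rewrite (exprS d) (exprSr q) mulrA -(mulrA d) -IHn -mulrA -cqd mulrA.
Qed.

(** Since [d = d ^+ k.+1 * q ^+ k] and [q * d] fixes [q ^+ k], moving [q ^+ k] past [r] shows that
    [d * r] absorbs [q * d] on the right and [r * d] absorbs it on the left; both then equal
    [d * q * r * d]. *)
Lemma drazin_comm (R : pzRingType) (q d r : R) :
  is_drazin_inverse q d -> GRing.comm q r -> GRing.comm d r.
Proof.
move=> dq; have [cqd dqd [k _ ek]] := dq.
move=> cqr; have /esym qkr := commrX k (esym cqr).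
have /esym qkd := commrX k (esym cqd).
have dkd : GRing.comm (d ^+ k.+1) (q ^+ k)
  by apply/commrX/commr_sym/commrX.
have qkE : q ^+ k * (q * d) = q ^+ k by rewrite mulrA -exprSr.
have qkE' : q * d * q ^+ k = q ^+ k by rewrite -mulrA -qkd mulrA -exprS.
have dE := drazin_powE _ _ _ k dq.
have drE : d * r = d ^+ k.+1 * r * q ^+ k by rewrite {1}dE -mulrA qkr mulrA.
have rdE : r * d = q ^+ k * r * d ^+ k.+1 by rewrite {1}dE dkd mulrA qkr.
have dr : d * r * (q * d) = d * r by rewrite drE -mulrA qkE.
have rd : q * d * (r * d) = r * d by rewrite rdE !mulrA qkE'.
by rewrite /GRing.comm -dr -rd [in RHS]cqd !mulrA -(mulrA d r q) -cqr mulrA.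
Qed.

(* The hypothesis [qqr = qrq] says that [q] commutes with [qr], so [d] does too. *)
Lemma drazin_left_comm (R : pzRingType) (p q d r : R) :
    is_drazin_inverse q d -> p * q * r = p * r * q -> q * q * r = q * r * q ->
  p * d * r = p * r * d.
Proof.
move=> dq pqr qqr; have [cqd dqd _] := dq.
have cqr : GRing.comm q (q * r) by rewrite /GRing.comm mulrA.
(* Writing [d = d * d * q] brings in [q * r], which commutes with [d]; [r] alone is not known to. *)
have drE : d * r = q * r * d * d.
  rewrite -(drazin_comm _ _ _ _ dq cqr) -mulrA -(drazin_comm _ _ _ _ dq cqr).
  by rewrite -{1}dqd -(mulrA d) cqd !mulrA.
by rewrite -mulrA drE !mulrA pqr -!(mulrA (p * r)) cqd dqd.
Qed.

(** * Commutation behind a left factor that kills [a * b - b * a] *)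

Section LeftCommuting.

Variables (R : pzRingType) (a b : R).

Definition kills_commutator (p : R) : Prop := p * (a * b - b * a) = 0.

(** The smallest subring containing [a] and [b] and closed under Drazin inverses of its elements
    that kill the commutator. For such a [q], generated elements [r] satisfy
    [q * q * r = q * r * q], as [drazin_left_comm] demands. *)
Inductive generated : R -> Prop :=
| generated1 : generated 1
| generated_l : generated a
| generated_r : generated b
| generatedD p q : generated p -> generated q -> generated (p + q)
| generatedN p : generated p -> generated (- p)
| generatedM p q : generated p -> generated q -> generated (p * q)
| generated_drazin q d : generated q -> kills_commutator q ->
    is_drazin_inverse q d -> generated d.

Hypotheses (hab : a ^+ 2 * b = a * b * a) (hba : b ^+ 2 * a = b * a * b).

Lemma kills_l : kills_commutator a.
Proof. by rewrite /kills_commutator mulrBr !mulrA -hab -expr2 subrr. Qed.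

Lemma kills_r : kills_commutator b.
Proof. by rewrite /kills_commutator mulrBr !mulrA -hba -expr2 subrr. Qed.

Lemma killsD p q :
  kills_commutator p -> kills_commutator q -> kills_commutator (p + q).
Proof. by rewrite /kills_commutator mulrDl => -> ->; rewrite addr0. Qed.

Lemma killsN p : kills_commutator p -> kills_commutator (- p).
Proof. by rewrite /kills_commutator mulNr => ->; rewrite oppr0. Qed.

Lemma kills_mull p q : kills_commutator q -> kills_commutator (p * q).
Proof. by rewrite /kills_commutator -mulrA => ->; rewrite mulr0. Qed.

Lemma kills_drazin q d :
  kills_commutator q -> is_drazin_inverse q d -> kills_commutator d.
Proof.
by move=> kq [cqd dqd _]; rewrite -dqd -mulrA cqd mulrA; apply: kills_mull.
Qed.

(** A product ending in [a], [b] or one of the Drazin inverses kills the commutator whatever [p] is;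
    the hypothesis on [p] serves the factor [1]. *)
Lemma kills_mulr p q :
  generated q -> kills_commutator p -> kills_commutator (p * q).
Proof.
move=> gq; elim: gq p => {q} [||| q r _ IHq _ IHr| q _ IHq| q r _ IHq _ IHr
  | q d _ _ kq dq] p kp.
- by rewrite mulr1.
- exact/kills_mull/kills_l.
- exact/kills_mull/kills_r.
- by rewrite mulrDr; apply: killsD; [apply: IHq | apply: IHr].
- by rewrite mulrN; apply/killsN/IHq.
- by rewrite mulrA; apply/IHr/IHq.
- exact/kills_mull/(kills_drazin _ _ kq dq).
Qed.

(** The induction [step] runs twice: from two letters to a letter and a generated element, then to
    two generated elements. The left factor must vary, since passing a product [z * t] enlarges it
    from [x] to [x * z]. *)
Lemma generated_left_comm q r p :
    generated q -> generated r -> kills_commutator p -> p * q * r = p * r * q.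
Proof.
have base x y : kills_commutator x -> (y = a \/ y = b) ->
    forall z, (z = a \/ z = b) -> x * y * z = x * z * y.
  move=> kx; have /eqP : x * (a * b - b * a) = 0 by [].
  rewrite mulrBr subr_eq0 !mulrA => /eqP e.
  by move=> [->|->] z [->|->].
have step y : (forall x, kills_commutator x -> x * y * a = x * a * y) ->
    (forall x, kills_commutator x -> x * y * b = x * b * y) ->
    forall z, generated z ->
    forall x, kills_commutator x -> x * y * z = x * z * y.
  move=> ya yb z; elim=> {z} [||| z t _ IHz _ IHt| z _ IHz| z t gz IHz _ IHt
    | z d gz IHz kz dz] x kx.
  - by rewrite !mulr1.
  - exact: ya.
  - exact: yb.
  - by rewrite !mulrDr mulrDl IHz ?IHt.
  - by rewrite !mulrN mulNr IHz.
  - by rewrite !mulrA IHz // IHt //; apply: kills_mulr.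
  - by apply/esym/(drazin_left_comm _ _ _ _ _ dz); apply/esym/IHz.
move=> gq gr; move: p; apply: (step) gr => p kp; apply/esym.
- by move: q gq p kp; apply: (step) => x kx; apply: base; auto.
- by move: q gq p kp; apply: (step) => x kx; apply: base; auto.
Qed.

Lemma generatedX p n : generated p -> generated (p ^+ n).
Proof.
move=> gp; elim: n => [|n IHn]; first exact: generated1.
by rewrite exprS; apply: generatedM.
Qed.

Lemma kills0 : kills_commutator 0.
Proof. by rewrite /kills_commutator mul0r. Qed.

Lemma generated0 : generated 0.
Proof.
rewrite -(subrr 1); apply: generatedD; first exact: generated1.
exact/generatedN/generated1.
Qed.

Lemma generated_sum (F : nat -> R) n :
  (forall i, generated (F i)) -> generated (\sum_(0 <= i < n) F i).
Proof.
by move=> gF; elim/big_ind: _ => *; auto using generated0, generatedD.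
Qed.

Lemma kills_sum (F : nat -> R) n :
  (forall i, kills_commutator (F i)) ->
  kills_commutator (\sum_(0 <= i < n) F i).
Proof. by move=> kF; elim/big_ind: _ => *; auto using kills0, killsD. Qed.

Lemma left_exprM p q n : kills_commutator p -> generated p -> generated q ->
  (p * q) ^+ n = p ^+ n * q ^+ n.
Proof.
move=> kp gp gq; elim: n => [|n IHn]; first by rewrite mulr1.
rewrite exprS IHn mulrA (generated_left_comm q (p ^+ n) p) //.
  by rewrite -exprS -mulrA -exprS.
exact: generatedX.
Qed.

Lemma generatedMn p n : generated p -> generated (p *+ n).
Proof.
move=> gp; elim: n => [|n IHn]; first exact: generated0.
by rewrite mulrS; apply: generatedD.
Qed.

Lemma killsMn p n : kills_commutator p -> kills_commutator (p *+ n).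
Proof.
move=> kp; elim: n => [|n IHn]; first exact: kills0.
by rewrite mulrS; apply: killsD.
Qed.

Hint Resolve kills_l kills_r killsD killsN kills_mull kills_mulr generated1
  generated_l generated_r generatedD generatedN generatedM generatedX
  : left_comm.

(* [f] is a variable constrained by an equation, rather than
   [spectral_idempotent a ad] itself, because [mulrDr] and [mulrDl] unify with
   the unfolding of the latter. *)
Variables (ad bd f : R).
Hypotheses (had : is_drazin_inverse a ad) (hbd : is_drazin_inverse b bd).
Hypothesis fE : f = 1 - a * ad.

Lemma kills_ad : kills_commutator ad.
Proof. exact: kills_drazin kills_l had. Qed.

Lemma kills_bd : kills_commutator bd.
Proof. exact: kills_drazin kills_r hbd. Qed.

Lemma generated_ad : generated ad.
Proof. exact: generated_drazin generated_l kills_l had. Qed.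

Lemma generated_bd : generated bd.
Proof. exact: generated_drazin generated_r kills_r hbd. Qed.

Hint Resolve kills_ad kills_bd generated_ad generated_bd : left_comm.

Ltac lc p q r :=
  rewrite (generated_left_comm q r p); [| solve [auto 20 with left_comm] ..].

(** * The complementary idempotents [e] and [f] *)

Let caad : a * ad = ad * a. Proof. by case: had. Qed.
Let adaad : ad * a * ad = ad. Proof. by case: had. Qed.
Let cbbd : b * bd = bd * b. Proof. by case: hbd. Qed.
Let bdbbd : bd * b * bd = bd. Proof. by case: hbd. Qed.

Local Notation w := (a + b).
Local Notation e := (a * ad).

Let e_idem : e * e = e.
Proof. by rewrite mulrA -(mulrA a) -caad -(mulrA a) caad adaad. Qed.
Let aadad : a * a * ad * ad = e.
Proof. by rewrite -(mulrA a a) {1}caad !mulrA -(mulrA e) e_idem. Qed.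
Let eaaad : e * a * a * ad = a * a * ad.
Proof. by rewrite -(mulrA a ad a) -caad -(mulrA _ a) -mulrA e_idem mulrA. Qed.
Let ef : e * f = 0. Proof. by rewrite fE mulrBr mulr1 e_idem subrr. Qed.
Let fe : f * e = 0. Proof. by rewrite fE mulrBl mul1r e_idem subrr. Qed.
Let ff : f * f = f. Proof. by rewrite {1}fE mulrBl mul1r ef subr0. Qed.
Let fad : f * ad = 0. Proof. by rewrite fE mulrBl mul1r caad adaad subrr. Qed.
Let adf : ad * f = 0. Proof. by rewrite fE mulrBr mulr1 mulrA adaad subrr. Qed.
Let cfa : f * a = a * f.
Proof. by rewrite fE mulrBl mulrBr mul1r mulr1 -mulrA -caad. Qed.

Lemma generated_f : generated f.
Proof. rewrite fE; auto 10 with left_comm. Qed.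
Hint Resolve generated_f : left_comm.

(** As [1 + ad * b = f + ad * w], the element is the identity on [f] and [ad * w] on [e]; there
    [a ^+ 2 * ad] inverts [ad], and [x] inverts [w] in the Drazin sense. *)
Lemma drazin_inverse_one_add x : is_drazin_inverse w x ->
  is_drazin_inverse (1 + ad * b) (f + a ^+ 2 * ad * x).
Proof.
move=> wx; have [cwx xwx [k k0 ek]] := wx.
have kx : kills_commutator x by apply: kills_drazin wx; auto with left_comm.
have gx : generated x by apply: generated_drazin wx; auto with left_comm.
have -> : 1 + ad * b = f + ad * w by rewrite fE mulrDr -caad addrA subrK.
have kw : kills_commutator w by auto with left_comm.
have gw : generated w by auto with left_comm.
move: (w) kw gw wx cwx xwx ek => v kv gv vx cvx xvx ek.
set y := f + a ^+ 2 * ad * x; set q := f + ad * v.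
have fax : f * (a ^+ 2 * ad * x) = 0.
  rewrite expr2 !mulrA cfa -(mulrA a f) cfa -!mulrA (mulrA f) fad.
  by rewrite mul0r !mulr0.
have qy : q * y = f + e * v * x.
  rewrite /q /y mulrDl !mulrDr ff fax.
  lc ad v f; rewrite adf mul0r addr0 add0r expr2 !mulrA.
  lc ad v a; lc (ad * a) v a; lc (ad * a * a) v ad.
  by rewrite -caad -(mulrA e) e_idem.
have yq : y * q = f + e * v * x.
  rewrite /q /y mulrDl !mulrDr ff.
  have -> : a ^+ 2 * ad * x * f = 0.
    lc (a ^+ 2 * ad) x f; by rewrite -(mulrA _ ad) adf mulr0 mul0r.
  rewrite (mulrA f) fad mul0r addr0 add0r expr2 !mulrA.
  lc (a * a * ad) x ad; lc (a * a * ad * ad) x v.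
  by rewrite aadad.
have yqy : y * q * y = y.
  rewrite yq {1}/y mulrDl !mulrDr ff fax.
  lc (e * v) x f; lc (a * ad) v f; rewrite ef !mul0r addr0 add0r.
  congr (_ + _); rewrite expr2 !mulrA.
  lc (e * v) x a; lc (e * v * a) x a; lc (e * v * a * a) x ad.
  lc (a * ad) v a; lc (e * a) v a; lc (e * a * a) v ad.
  by rewrite -(mulrA _ v) cvx -mulrA xvx eaaad.
split=> //; first by rewrite qy yq.
exists k => //.
(* The exponent [k] of [x] serves again: [q ^+ k * (1 - q * y)] becomes
   [e * ad ^+ k * v ^+ k * (1 - v * x)]. *)
have q1 : 1 - q * y = e * (1 - v * x).
  by rewrite qy fE opprD opprB addrA subrKC mulrBr mulr1 mulrA.
have qe z : q * (e * z) = ad * v * e * z.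
  by rewrite /q mulrDl mulrA fe mul0r add0r mulrA.
have qke : q ^+ k * e = e * ad ^+ k * v ^+ k.
  elim: (k) => [|n IHn]; first by rewrite mul1r !mulr1.
  rewrite exprS -mulrA IHn -mulrA qe mulrA.
  lc ad v (a * ad); lc (ad * e) v (ad ^+ n).
  by rewrite !exprS !mulrA caad.
apply/eqP; rewrite -subr_eq0 exprSr -mulrA -{1}(mulr1 (q ^+ k)) -mulrBr q1.
by rewrite mulrA qke -mulrA mulrBr mulr1 mulrA -exprSr -ek subrr mulr0.
Qed.

(** In [1 + ad * b] the factor [b] stands behind [ad], so this element commutes with [a] outright,
    and so does [y]. Hence [e * w = a * e * (1 + ad * b)] is a product of commuting factors, with
    Drazin inverses [ad] and [y]. *)
Lemma drazin_inverse_on_e y : is_drazin_inverse (1 + ad * b) y ->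
  [/\ is_drazin_inverse (e * w) (ad * y), GRing.comm a (ad * y)
    & e * (ad * y) = ad * y].
Proof.
set q := 1 + ad * b => qy; have [cqy yqy [k k0 ek]] := qy.
have adba : ad * b * a = a * (ad * b) by lc ad b a; rewrite -caad mulrA.
have cqa : GRing.comm q a.
  by rewrite /GRing.comm /q mulrDl mulrDr mul1r mulr1 adba.
have cya := drazin_comm _ _ _ _ qy cqa.
have cyad := commr_sym (drazin_comm _ _ _ _ had (commr_sym cya)).
have cqad := commr_sym (drazin_comm _ _ _ _ had (commr_sym cqa)).
have cae : GRing.comm a e by rewrite /GRing.comm {1}caad mulrA.
have ead : e * ad = ad by rewrite caad adaad.
have cqe : GRing.comm q e by apply: commrM.
have cye : GRing.comm y e by apply: commrM.
have gE : e * w = a * e * q.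
  rewrite /q !mulrDr mulr1 cae; congr (_ + _).
  by rewrite -cae -!mulrA (mulrA a ad (ad * b)) (mulrA e) ead.
have gt : e * w * (ad * y) = e * (q * y).
  by rewrite gE -!mulrA (mulrA q) cqad -!mulrA (mulrA ad ad) !mulrA aadad.
have tg : ad * y * (e * w) = e * (q * y).
  rewrite gE -(mulrA ad) (mulrA y) (commrM cya cye) !mulrA -caad.
  by rewrite -(mulrA e a ad) e_idem -(mulrA e) -cqy mulrA.
have ceqy : GRing.comm (q * y) ad by apply/commr_sym/commrM; apply/commr_sym.
split; last by rewrite mulrA ead.
  split; first by rewrite gt tg.
    rewrite tg -(mulrA e) (mulrA _ ad) ceqy cqy -(mulrA ad) yqy.
    by rewrite (mulrA e) ead.
  exists k => //; rewrite exprSr -(mulrA _ (e * w)) gt.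
  have -> : (e * w) ^+ k = (a * e) ^+ k * q ^+ k.
    by rewrite gE exprMn_comm //; apply/commr_sym/commrM.
  rewrite -mulrA (mulrA (q ^+ k)) -(commrX k (commr_sym cqe)) -(mulrA e).
  rewrite (mulrA _ q) -exprSr -ek.
  (* Positivity of [k] matters: only a positive power of [a * e] absorbs [e]. *)
  rewrite [RHS]mulrA; congr (_ * _); case: (k) k0 => // n _.
  by rewrite exprSr -(mulrA _ (a * e) e) -(mulrA a e e) e_idem.
exact: commrM.
Qed.

(** * The Drazin inverse of [a + b] *)

(** A binomial argument: peeling off one factor [w] replaces [p] by [p * a] or [p * b] and lowers
    the matching exponent. *)
Lemma left_nilpotentD p i j : kills_commutator p ->
  p * a ^+ i = 0 -> p * b ^+ j = 0 -> p * w ^+ (i + j) = 0.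
Proof.
move En: (i + j)%N => n.
elim: n p i j En => [|n IHn] p [|i] [|j] //= En kp; rewrite ?mulr1 => pa pb;
  rewrite ?pa ?pb ?mul0r //.
rewrite exprS mulrA mulrDr mulrDl.
rewrite (IHn (p * a) i j.+1) ?(IHn (p * b) i.+1 j) ?addr0 -?mulrA -?exprS //;
  try by [auto with left_comm | move: En; rewrite ?addSn ?addnS; case].
- by rewrite mulrA; lc p b (a ^+ i.+1); rewrite pa mul0r.
- by rewrite mulrA; lc p a (b ^+ j.+1); rewrite pb mul0r.
Qed.

(** Multiplying [v * (z * z)] by [v] on either side gives [v * z], which turns the one-sided
    hypotheses on [z] into two-sided ones. *)
Lemma drazin_inverse_of_left v z : kills_commutator v -> generated v ->
    generated z -> v * z * v * z = v * z ->
    (exists2 k, (0 < k)%N & v ^+ k = v ^+ k.+1 * z) ->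
  is_drazin_inverse v (v * (z * z)).
Proof.
move=> kv gv gz vzvz [k k0 ek].
have vvz : v * v * z * z = v * z by rewrite -[RHS]vzvz; lc v z v.
have xv : v * (z * z) * v = v * z by lc v (z * z) v; rewrite mulrA.
have vvzz : v * (v * (z * z)) = v * z by rewrite !mulrA.
split; first by rewrite xv vvzz.
  by rewrite xv !mulrA vzvz.
by exists k => //; rewrite exprSr -mulrA vvzz {1}ek exprSr mulrA.
Qed.

(** The formula is [v * (z * z)] written out, where [v = w], [z = t + S] and [S] is the first sum.
    The cross terms of [z * z] vanish because [t] lives on [e] and [S] on [f]. *)
Lemma drazin_inverse_add s t : (0 < s)%N -> a ^+ s * f = 0 ->
    is_drazin_inverse (e * w) t -> GRing.comm a t -> e * t = t ->
  is_drazin_inverse w (t + f * b * t ^+ 2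
    + \sum_(0 <= i < s) bd ^+ i.+1 * (- a) ^+ i * f
    + (1 - b * bd) * a *
        (\sum_(0 <= i < s.-1) i.+1%:R * bd ^+ i.+2 * (- a) ^+ i * f)).
Proof.
move=> s_gt0 asf evt cat et; have [cevt tevt [k k0 ek]] := evt.
have kw : kills_commutator w by auto with left_comm.
have gw : generated w by auto with left_comm.
have left_nil := left_nilpotentD.
have [v vE] : exists v, v = w by exists w.
rewrite -!vE in kw gw evt cevt tevt ek left_nil *.
have ke : kills_commutator e by auto with left_comm.
have ge : generated e by auto with left_comm.
have kt : kills_commutator t by apply: kills_drazin evt; auto with left_comm.
have gt : generated t by apply: generated_drazin evt; auto with left_comm.
have te : t * e = t.
  have cadt := drazin_comm _ _ _ _ had cat.
  by rewrite mulrA -cat -mulrA -cadt mulrA et.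
have ft : f * t = 0 by rewrite -et mulrA fe mul0r.
have tf : t * f = 0 by rewrite -te -mulrA ef mulr0.
pose T i := bd ^+ i.+1 * (- a) ^+ i * f.
have gT i : generated (T i) by rewrite /T; auto 20 with left_comm.
have kT i : kills_commutator (T i) by rewrite /T exprS; auto 20 with left_comm.
have Tf i : T i * f = T i by rewrite /T -mulrA ff.
have bdbT i : bd * b * T i = T i by rewrite /T exprS !mulrA bdbbd.
(* Multiplication by [bd * a] shifts the geometric series with a sign; since [T s = 0], the sum
   telescopes to [bd * v * S = bd * f]. *)
have bdaT i : bd * a * T i = - T i.+1.
  rewrite /T !mulrA; lc bd a (bd ^+ i.+1); rewrite -exprS.
  by rewrite (exprS (- a)) mulNr mulrN mulNr opprK !mulrA.
have Ts : T s = 0 by rewrite /T -mulrA exprNn -mulrA asf !mulr0.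
pose S := \sum_(0 <= i < s) T i.
have gS : generated S by apply: generated_sum.
have kS : kills_commutator S by apply: kills_sum.
have Sf : S * f = S by rewrite mulr_suml; apply: eq_bigr => i _.
have bdbS : bd * b * S = S by rewrite mulr_sumr; apply: eq_bigr => i _.
have bdaS : bd * a * S = bd * f - S.
  suff H n : bd * a * (\sum_(0 <= i < n) T i) =
             bd * f - \sum_(0 <= i < n) T i - T n.
    by rewrite H Ts subr0.
  elim: n => [|n IHn]; first by rewrite !big_geq // mulr0 subr0 /T mulr1 subrr.
  by rewrite !big_nat_recr //= mulrDr IHn bdaT opprD addrA.
have bdvS : bd * v * S = bd * f.
  by rewrite vE mulrDr mulrDl bdaS bdbS subrK.
have tS : t * S = 0 by rewrite -Sf mulrA; lc t S f; rewrite tf mul0r.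
have St : S * t = 0 by rewrite -Sf -mulrA ft mulr0.
pose z := t + S.
have gz : generated z by apply: generatedD.
(* Behind [v], the product [v * z] splits into a projection on the [e] part and one on the [f] part;
   the latter involves only [b], as [a] is nilpotent there. *)
have vvz : v * (v * z) = v * (e * v * t + f * b * bd).
  rewrite /z !mulrDr; congr (_ + _).
    by rewrite -{1}et !mulrA; lc v v a; lc (v * a) v ad.
  rewrite -{1}bdbS !mulrA; lc (v * v) bd b; lc v v b; lc (v * b) v bd.
  by rewrite -!mulrA (mulrA bd) bdvS !mulrA; lc (v * b) bd f; lc v b f.
have zz : z * z = t * t + S * S.
  by rewrite /z mulrDl !mulrDr tS St addr0 add0r.
have vzvz : v * z * v * z = v * z.
  lc v z v; rewrite -(mulrA v v) vvz (mulrDr v) mulrDl /z !mulrDr.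
  have -> : v * (e * v * t) * t = v * t by rewrite -(mulrA v) cevt tevt.
  have -> : v * (e * v * t) * S = 0 by rewrite -!mulrA tS !mulr0.
  have -> : v * (f * b * bd) * t = 0.
    rewrite !mulrA; lc (v * f * b) bd t; lc (v * f) b t.
    by rewrite -(mulrA v) ft mulr0 !mul0r.
  have -> : v * (f * b * bd) * S = v * S.
    rewrite !mulrA; lc (v * f) b bd; rewrite -!mulrA (mulrA bd) bdbS mulrA.
    by lc v f S; rewrite -mulrA Sf.
  by rewrite addr0 add0r.
(* The exponent [k] settles the [e] part. On the [f] part, [v * (f * (1 - b * bd))] is annihilated
   by [a ^+ s] and by [b ^+ l], hence by [v ^+ (s + l)]. One more factor [v] is spent on [vvz]. *)
have vk : exists2 k, (0 < k)%N & v ^+ k = v ^+ k.+1 * z.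
  have [_ _ [l _ el]] := hbd.
  have evk : e * v ^+ k = e * v ^+ k * (v * t).
    have eX : e ^+ k = e.
      by case: (k) k0 => // n _; elim: n => // n IHn; rewrite exprS IHn e_idem.
    move: ek; rewrite !(left_exprM e v) // exprS eX e_idem exprSr !mulrA => ek.
    exact: ek.
  have vXM j p : generated p -> v ^+ j * (v * p) = v * p * v ^+ j.
    by move=> gp; rewrite mulrA -exprSr exprS; lc v (v ^+ j) p.
  have onE j : v ^+ (j + k) * (v * e) = v ^+ (j + k) * (v * (e * v * t)).
    rewrite exprD -!(mulrA (v ^+ j)) (vXM k) // -(mulrA v) evk.
    rewrite (vXM k); last by auto with left_comm.
    rewrite !mulrA; lc (v ^+ j * v * a * ad) (v ^+ k) v.
    by lc (v ^+ j * v * a * ad * v) (v ^+ k) t.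
  have onF j : v ^+ (j + (s + l)) * (v * f) =
               v ^+ (j + (s + l)) * (v * (f * b * bd)).
    apply/eqP; rewrite -subr_eq0 -mulrBr -mulrBr exprD -mulrA -(mulrA f).
    rewrite -{1}(mulr1 f) -mulrBr vXM; last by auto 20 with left_comm.
    rewrite left_nil ?mulr0 //; first by auto 20 with left_comm.
      rewrite mulrA; lc (v * f) (1 - b * bd) (a ^+ s).
      by rewrite -(mulrA v) (commrX s cfa) asf mulr0 mul0r.
    rewrite -!mulrA mulrBl mul1r cbbd -mulrA -exprS.
    by rewrite (commrX l.+1 (commr_sym cbbd)) -el subrr !mulr0.
  exists (k + (s + l)).+1 => //; rewrite !exprSr.
  rewrite -(mulrA _ v v) -(mulrA _ (v * v) z) -(mulrA v v z) vvz.
  rewrite !mulrDr -onF addnC -onE -!mulrDr addnC.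
  by rewrite fE subrKC mulr1.
(* Here [f * a * t ^+ 2 = 0] because [a] commutes with [t]. But [f] leaves the commutator unchanged,
   so [b] cannot be moved past [t] behind it, and [f * b * t ^+ 2] stays. *)
have vtt : v * (t * t) = t + f * b * t ^+ 2.
  have -> : v * (t * t) = e * v * (t * t) + f * v * (t * t).
    by rewrite -!mulrDl fE subrKC mul1r.
  congr (_ + _); first by rewrite mulrA cevt tevt.
  rewrite vE mulrDr mulrDl -(mulrA f a) (mulrA a) cat -(mulrA t).
  by rewrite (mulrA f t) ft mul0r add0r.
(* The weight [i.+1] counts the pairs of terms of [S * S] whose indices add up to [i]. *)
pose Q n := \sum_(0 <= i < n) i.+1%:R * bd ^+ i.+2 * (- a) ^+ i * f.
have QE n : Q n = \sum_(0 <= i < n) (bd * T i) *+ i.+1.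
  by apply: eq_bigr => i _; rewrite /T -!mulrA mulr_natl (mulrA bd) -exprS.
have QS n : Q n.+1 = Q n + (bd * T n) *+ n.+1 by rewrite !QE big_nat_recr.
have gQ n : generated (Q n).
  rewrite QE; apply: generated_sum => i.
  by apply/generatedMn/generatedM; auto with left_comm.
have kQ n : kills_commutator (Q n).
  by rewrite QE; apply: kills_sum => i; apply/killsMn/kills_mull.
have Qf n : Q n * f = Q n.
  by rewrite mulr_suml; apply: eq_bigr => i _; rewrite -mulrA ff.
have bdaQ : bd * a * Q s = bd * S - Q s.
  suff H n : bd * a * Q n =
             bd * (\sum_(0 <= i < n) T i) - Q n - (bd * T n) *+ n.
    by rewrite H Ts mulr0 mul0rn subr0.
  elim: n => [|n IHn]; first by rewrite QE !big_geq // !mulr0 !subr0.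
  rewrite QS big_nat_recr //= mulrDr IHn mulrnAr mulrA.
  lc bd a bd; rewrite -(mulrA bd bd) -(mulrA bd _ (T n)) bdaT mulrN mulNrn.
  congr (_ - _); rewrite mulrDr (mulrS _ n) !opprD (addrCA (- Q n)).
  by rewrite [RHS]addrA addrK addrA.
(* The defect [D] satisfies [D = - bd a D] and [bd a^s D = 0], hence vanishes. *)
have SS : S * S = Q s.
  apply/eqP; rewrite -subr_eq0; apply/eqP; set D := S * S - Q s.
  have gD : generated D by rewrite /D; auto with left_comm.
  have kD : kills_commutator D by rewrite /D; auto with left_comm.
  have Df : D * f = D by rewrite mulrBl -mulrA Sf Qf.
  have bdaD : bd * a * D = - D.
    rewrite /D mulrBr bdaQ mulrA bdaS mulrBl; lc bd f S.
    by rewrite -(mulrA bd) Sf !opprB addrC addrA subrK.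
  have H n m : (m + n = s)%N -> bd * a ^+ m * D = 0.
    elim: n m => [|n IHn] m mn.
      rewrite addn0 in mn; rewrite mn -Df mulrA; lc (bd * a ^+ s) D f.
      by rewrite -(mulrA bd) asf mulr0 mul0r.
    rewrite -[D]opprK -bdaD mulrN !mulrA; lc bd (a ^+ m) bd.
    rewrite -(mulrA _ _ a) -exprSr -(mulrA bd bd) -mulrA IHn ?mulr0 ?oppr0 //.
    by rewrite addSnnS.
  by rewrite -[D]opprK -bdaD -{1}(expr1 a) (H s.-1) ?oppr0 // add1n prednK.
have vQ : v * Q s = S + (1 - b * bd) * a * Q s.-1.
  (* This is why the last sum stops one index earlier: the factor [a] turns the term of index [s.-1]
     into a multiple of [a ^+ s * f = 0]. *)
  have aQ : a * Q s.-1 = a * Q s.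
    rewrite -{2}(prednK s_gt0) QS mulrDr mulrnAr.
    suff -> : a * (bd * T s.-1) = 0 by rewrite mul0rn addr0.
    have af : a * (- a) ^+ s.-1 * f = 0.
      apply: oppr_inj; rewrite oppr0 -!mulNr -exprS prednK //.
      by rewrite exprNn -mulrA asf mulr0.
    rewrite /T !mulrA; lc (a * bd) (bd ^+ s.-1.+1) ((- a) ^+ s.-1).
    lc a bd ((- a) ^+ s.-1).
    lc (a * (- a) ^+ s.-1 * bd) (bd ^+ s.-1.+1) f.
    by lc (a * (- a) ^+ s.-1) bd f; rewrite af !mul0r.
  rewrite -mulrA aQ mulrBl mul1r -(mulrA b) (mulrA bd) bdaQ mulrBr opprB.
  rewrite (mulrA b bd) cbbd bdbS vE mulrDl addrCA; congr (_ + _).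
  by rewrite subrKC.
have -> : t + f * b * t ^+ 2 + S + (1 - b * bd) * a * Q s.-1 = v * (z * z).
  by rewrite zz mulrDr vtt SS vQ !addrA.
exact: drazin_inverse_of_left.
Qed.

End LeftCommuting.

Theorem theorem3p3 (R : pzRingType) (a b ad bd : R) (s : nat)
    (had : is_drazin_inverse a ad) (hbd : is_drazin_inverse b bd)
    (hab : a ^+ 2 * b = a * b * a) (hba : b ^+ 2 * a = b * a * b)
    (hs : is_drazin_index a s) :
  (drazin_invertible (a + b) <-> drazin_invertible (1 + ad * b)) /\
  (forall x y : R,
     is_drazin_inverse (a + b) x -> is_drazin_inverse (1 + ad * b) y ->
     x = ad * y + spectral_idempotent a ad * b * (ad * y) ^+ 2
         + \sum_(0 <= i < s)
              bd ^+ i.+1 * (- a) ^+ i * spectral_idempotent a ad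
         + spectral_idempotent b bd * a *
             (\sum_(0 <= i < s.-1)
                i.+1%:R * bd ^+ i.+2 * (- a) ^+ i * spectral_idempotent a ad)
     /\
     y = spectral_idempotent a ad + a ^+ 2 * ad * x).
Proof.
have asf : (0 < s)%N /\ a ^+ s * spectral_idempotent a ad = 0.
  case: hs => ad' had' [s_gt0 es _]; split=> //.
  rewrite (is_drazin_inverse_unique had had').
  by rewrite /spectral_idempotent mulrBr mulr1 mulrA -exprSr -es subrr.
have [s_gt0 {}asf] := asf.
have toq x := drazin_inverse_one_add R a b hab hba ad _ had erefl x.
have tow y (qy : is_drazin_inverse (1 + ad * b) y) :=
  let: And3 gt cat et := drazin_inverse_on_e R a b hab hba ad had y qy in
  drazin_inverse_add R a b hab hba ad bd _ had hbd erefl s _ s_gt0 asf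
    gt cat et.
split.
  by split=> [[x /toq qx] | [y /tow wy]]; eexists; eassumption.
(* Uniqueness identifies [x] and [y] with the inverses constructed above, taken at [t = ad * y]. *)
move=> x y wx qy; split.
  exact: is_drazin_inverse_unique wx (tow _ qy).
exact: is_drazin_inverse_unique qy (toq _ wx).
Qed.
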